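(* Let $m_1,m_2,n_1,n$ be positive integers with $m_1\ge n_1$, and let $\mathcal{A}\in\mathbb{R}^{m_1\times n_1\times n}$ and $\mathcal{B}\in\mathbb{R}^{m_2\times n_1\times n}$. Then there exist orthogonal tensors $\mathcal{U}\in\mathbb{R}^{m_1\times m_1\times n}$ and $\mathcal{V}\in\mathbb{R}^{m_2\times m_2\times n}$ and an invertible tensor $\mathcal{X}\in\mathbb{R}^{n_1\times n_1\times n}$ such that $$\mathcal{U}^{\mathrm T}*\mathcal{A}*\mathcal{X}=\mathcal{D}_{\mathcal{A}},\qquad \mathcal{V}^{\mathrm T}*\mathcal{B}*\mathcal{X}=\mathcal{D}_{\mathcal{B}},$$ where $\mathcal{D}_{\mathcal{A}}\in\mathbb{R}^{m_1\times n_1\times n}$ and $\mathcal{D}_{\mathcal{B}}\in\mathbb{R}^{m_2\times n_1\times n}$ are f-diagonal tensors.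
   Context: All tensors are third-order arrays. For $\mathcal{A}\in\mathbb{R}^{n_1\times n_2\times n_3}$, the frontal slices are the matrices $A_k=\mathcal{A}(:,:,k)\in\mathbb{R}^{n_1\times n_2}$, $k=1,\dots,n_3$. $\mathrm{unfold}(\mathcal{A})$ is the $n_1n_3\times n_2$ matrix obtained by stacking $A_1,\dots,A_{n_3}$ vertically, $\mathrm{fold}$ is its inverse operation, and $\mathrm{bcirc}(\mathcal{A})$ is the $n_1n_3\times n_2n_3$ block circulant matrix whose $(i,j)$ block is $A_{((i-j)\bmod n_3)+1}$ (so its first block column is $\mathrm{unfold}(\mathcal{A})$). T-product: for $\mathcal{A}\in\mathbb{R}^{n_1\times n_2\times n_3}$ and $\mathcal{B}\in\mathbb{R}^{n_2\times p\times n_3}$, $\mathcal{A}*\mathcal{B}=\mathrm{fold}(\mathrm{bcirc}(\mathcal{A})\cdot\mathrm{unfold}(\mathcal{B}))\in\mathbb{R}^{n_1\times p\times n_3}$. Transpose: $\mathcal{A}^{\mathrm T}\in\mathbb{R}^{n_2\times n_1\times n_3}$ is obtained by transposing each frontal slice and then reversing the order of the transposed slices $2$ through $n_3$. Identity tensor: $\mathcal{I}\in\mathbb{R}^{m\times m\times \ell}$ has first frontal slice the $m\times m$ identity matrix and all other frontal slices zero. A tensor $\mathcal{Q}\in\mathbb{R}^{m\times m\times\ell}$ is orthogonal if $\mathcal{Q}^{\mathrm T}*\mathcal{Q}=\mathcal{Q}*\mathcal{Q}^{\mathrm T}=\mathcal{I}$. A tensor $\mathcal{X}\in\mathbb{R}^{m\times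 m\times\ell}$ is invertible if there is a tensor $\mathcal{Y}\in\mathbb{R}^{m\times m\times\ell}$ with $\mathcal{X}*\mathcal{Y}=\mathcal{Y}*\mathcal{X}=\mathcal{I}$. A tensor is f-diagonal if each of its frontal slices is a (possibly rectangular) diagonal matrix. *)

(* Defs.v *)
From HB Require Import structures.
From mathcomp Require Import all_boot all_order all_algebra.
From mathcomp Require Import reals.

Set Implicit Arguments.
Unset Strict Implicit.
Unset Printing Implicit Defensive.

Import GRing.Theory.

Declare Scope tensor_scope.
Delimit Scope tensor_scope with T.

Local Open Scope ring_scope.

(* An m x n x l tensor is the family of its l frontal slices; slices are      *)
(* numbered 0, ..., l - 1, so that slice k here is A_(k + 1) in 1-based       *)
(* numbering.                                                                 *)
Notation tensor R m n l := {ffun 'I_l -> 'M[R]_(m, n)}.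

(* k mod l as an index; i only witnesses 0 < l. *)
Definition modi (l : nat) (i : 'I_l) (k : nat) : 'I_l :=
  Ordinal (ltn_pmod k (leq_ltn_trans (leq0n i) (ltn_ord i))).

(* (i - j) mod l; adding l first avoids the truncation of nat subtraction. *)
Definition subi (l : nat) (i j : 'I_l) : 'I_l := modi i (i + (l - j))%N.

Definition tunfold (R : Type) (m n l : nat) (A : tensor R m n l) :
    'M[R]_(\sum_(k < l) m, n) :=
  \mxcol_(k < l) A k.

Definition tfold (R : Type) (m n l : nat) (M : 'M[R]_(\sum_(k < l) m, n)) :
    tensor R m n l :=
  [ffun k => submxcol M k].

Definition bcirc (R : Type) (m n l : nat) (A : tensor R m n l) :
    'M[R]_(\sum_(i < l) m, \sum_(j < l) n) :=
  \mxblock_(i < l, j < l) A (subi i j).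

Definition tmul (R : pzRingType) (m n p l : nat)
    (A : tensor R m n l) (B : tensor R n p l) : tensor R m p l :=
  tfold (bcirc A *m tunfold B).

(* (l - k) mod l fixes k = 0 and reverses the order of 1, ..., l - 1. *)
Definition ttr (R : Type) (m n l : nat) (A : tensor R m n l) : tensor R n m l :=
  [ffun k => (A (modi k (l - k)%N))^T].

Definition tid (R : pzRingType) (m l : nat) : tensor R m m l :=
  [ffun k : 'I_l => if k == 0%N :> nat then 1%:M else 0].
Arguments tid {R m l}.

Notation "A *t B" := (tmul A B) (at level 40, left associativity) : tensor_scope.
Notation "A ^tr" := (ttr A) (at level 1, format "A ^tr") : tensor_scope.

Local Open Scope tensor_scope.

Definition orthogonal_tensor (R : pzRingType) (m l : nat)
    (Q : tensor R m m l) : Prop :=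
  Q^tr *t Q = tid /\ Q *t Q^tr = tid.

Definition invertible_tensor (R : pzRingType) (m l : nat)
    (X : tensor R m m l) : Prop :=
  exists Y : tensor R m m l, X *t Y = tid /\ Y *t X = tid.

Definition f_diagonal (R : pzRingType) (m n l : nat)
    (A : tensor R m n l) : Prop :=
  forall k : 'I_l, is_diag_mx (A k).

(* Main.v *)
(* The discrete Fourier transform along the third dimension turns the
   T-product into slicewise products of complex matrices and the tensor
   transpose into the conjugate transpose; its values on real tensors are the
   families whose slices k and -k are conjugate.  So it suffices to decompose
   each pair of slices by a matrix GSVD: a real one when k = -k, and for the
   other k a complex one whose conjugate is used at -k.

   For the matrix GSVD, a common deflation by eigenvectors of the pencil
   (A^* A, A^* A + B^* B) gives an invertible X such that both A X and B X have
   orthogonal columns.  A matrix M with orthogonal columns becomes diagonal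
   after a unitary change of basis on the left and a permutation of its columns
   that puts nonzero columns first; the permutation is needed for B only,
   because A has at least as many rows as columns.  Real and complex matrices
   are treated together, over a field with an involution conj. *)
Require Import Defs.
From HB Require Import structures.
From mathcomp Require Import all_boot all_order all_fingroup all_algebra.
From mathcomp Require Import cyclic separable cyclotomic ring complex.
From mathcomp Require Import reals.

Set Implicit Arguments.
Unset Strict Implicit.
Unset Printing Implicit Defensive.

Import Order.TTheory GRing.Theory Num.Theory.

Local Open Scope ring_scope.
Local Open Scope tensor_scope.

(** * Unitary reduction over a field with involution *)

Section Dagger.
Variables (F : pzRingType) (conj : {rmorphism F -> F}).

Definition dagger m n (M : 'M[F]_(m, n)) : 'M_(n, m) := (map_mx conj M)^T.

Lemma daggerE m n (M : 'M_(m, n)) i j : dagger M i j = conj (M j i).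
Proof. by rewrite !mxE. Qed.

Lemma dagger1 n : dagger 1%:M = 1%:M :> 'M_n.
Proof. by rewrite /dagger map_mx1 trmx1. Qed.

Lemma dagger0 m n : dagger 0 = 0 :> 'M_(n, m).
Proof. by rewrite /dagger map_mx0 trmx0. Qed.

Lemma daggerB m n (M N : 'M_(m, n)) : dagger (M - N) = dagger M - dagger N.
Proof. by rewrite /dagger map_mxB linearB. Qed.

End Dagger.

Section InvolutiveField.
Variables (F : numFieldType) (conj : {rmorphism F -> F}).
(** This one identity covers both complex conjugation and the identity of a real field. It makes
    [u *m u^d] a sum of squared norms, hence definite. *)
Hypothesis mul_conj : forall x, x * conj x = `|x| ^+ 2.

Local Notation "M ^d" := (dagger conj M) : ring_scope.

Lemma conj_nonneg x : 0 <= x -> conj x = x.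
Proof.
move=> x_ge0; have [->|x_neq0] := eqVneq x 0; first by rewrite rmorph0.
by apply: (mulfI x_neq0); rewrite mul_conj ger0_norm.
Qed.

(** Applying [conj] to x * conj x = |x|^2 fixes the right side, which is nonnegative; cancelling
    conj x gives the claim. *)
Lemma conjK : involutive conj.
Proof.
move=> x; have [->|x_neq0] := eqVneq x 0; first by rewrite !rmorph0.
apply: (mulfI (_ : conj x != 0)); first by rewrite fmorph_eq0.
have:= conj_nonneg (exprn_ge0 2 (normr_ge0 x)).
by rewrite -mul_conj rmorphM /= => ->; rewrite mulrC.
Qed.

Lemma daggerM m n p (M : 'M_(m, n)) (N : 'M_(n, p)) :
  (M *m N)^d = N^d *m M^d.
Proof. by rewrite /dagger map_mxM trmx_mul. Qed.

Lemma daggerZ m n a (M : 'M_(m, n)) : (a *: M)^d = conj a *: M^d.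
Proof. by rewrite /dagger map_mxZ linearZ. Qed.

Lemma daggerK m n (M : 'M_(m, n)) : M^d^d = M.
Proof. by apply/matrixP => i j; rewrite !daggerE conjK. Qed.

Lemma sqr_row_sum n (u : 'rV_n) : (u *m u^d) 0 0 = \sum_i `|u 0 i| ^+ 2.
Proof. by rewrite mxE; apply: eq_bigr => i _; rewrite daggerE mul_conj. Qed.

Lemma sqr_row_ge0 n (u : 'rV_n) : 0 <= (u *m u^d) 0 0.
Proof. by rewrite sqr_row_sum sumr_ge0 // => i _; rewrite exprn_ge0. Qed.

Lemma sqr_row_eq0 n (u : 'rV_n) : ((u *m u^d) 0 0 == 0) = (u == 0).
Proof.
apply/idP/eqP => [|->]; last by rewrite mul0mx mxE.
rewrite sqr_row_sum psumr_eq0 => [|i _]; last by rewrite exprn_ge0.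
move/allP=> u0; apply/rowP => i; rewrite mxE; apply/eqP.
by have:= u0 i (mem_index_enum _); rewrite expf_eq0 normr_eq0.
Qed.

(** The form is the squared norm of [z *m M]. *)
Lemma row_gram_eq0 m n (M : 'M_(m, n)) (z : 'rV_m) :
  z *m (M *m M^d) *m z^d = 0 -> z *m M = 0.
Proof.
move=> zMMz0; apply/eqP; rewrite -sqr_row_eq0 daggerM.
by rewrite mulmxA -(mulmxA z) zMMz0 mxE.
Qed.

Hypothesis sqrt_ex : forall x : F, 0 <= x -> exists2 y : F, 0 <= y & y ^+ 2 = x.

(* The reflection exchanging the line of u with that of the first basis
   vector; the phase a avoids a cancellation in w. *)
Lemma householder n (u : 'rV[F]_(1 + n)) :
  exists (Q : 'M_(1 + n)) c, Q^d *m Q = 1%:M /\ u *m Q = c *: delta_mx 0 0.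
Proof.
have [->|u_neq0] := eqVneq u 0.
  by exists 1%:M, 0; rewrite dagger1 mul1mx mul0mx scale0r.
(* [v] is the norm of [u]. *)
have [v v_ge0 v2E] := sqrt_ex (sqr_row_ge0 u).
have v_gt0: 0 < v.
  rewrite lt_def v_ge0 andbT; apply: contraNneq u_neq0 => v0.
  by rewrite -sqr_row_eq0 -v2E v0 expr0n.
pose x := u 0 0.
have [a [aa1 xE]] : exists a, conj a * a = 1 /\ x = `|x| * a.
  have [x0|x_neq0] := eqVneq x 0.
    by exists 1; rewrite rmorph1 x0 normr0 mul0r mul1r.
  have nx_neq0 : `|x| != 0 by rewrite normr_eq0.
  exists (x / `|x|); split; last by rewrite mulrC divfK.
  by rewrite mulrC mul_conj normf_div normr_id divff ?expr1n.
pose e : 'rV[F]_(1 + n) := delta_mx 0 0.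
have ue : u *m e^d = x%:M.
  rewrite [LHS]mx11_scalar mxE (bigD1 0) //= big1 => [|i i_neq0].
    by rewrite daggerE mxE !eqxx addr0 rmorph1 mulr1.
  by rewrite daggerE mxE (negPf i_neq0) andbF rmorph0 mulr0.
have ee : e *m e^d = 1%:M.
  rewrite [LHS]mx11_scalar mxE (bigD1 0) //= big1 => [|i i_neq0].
    by rewrite daggerE mxE !eqxx addr0 /= mul1r rmorph1.
  by rewrite daggerE mxE (negPf i_neq0) andbF mul0r.
have eu : e *m u^d = (conj x)%:M.
  rewrite -[LHS]daggerK daggerM daggerK ue.
  by rewrite /dagger map_scalar_mx tr_scalar_mx.
have uu : u *m u^d = (v ^+ 2)%:M by rewrite v2E -mx11_scalar.
(* [s] is both the product of u with w and half the squared norm of w, so the reflection along w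
   sends u to u - w, a multiple of e. *)
pose s := v * (v + `|x|).
have s_gt0 : 0 < s by rewrite mulr_gt0 // ltr_wpDr.
have s_neq0 : s != 0 by rewrite gt_eqF.
pose w := u + (a * v) *: e.
have wd : w^d = u^d + (conj a * v) *: e^d.
  rewrite /w /dagger map_mxD linearD /= map_mxZ linearZ /= rmorphM /=.
  by rewrite (conj_nonneg v_ge0).
have uw : u *m w^d = s%:M.
  rewrite wd mulmxDr -scalemxAr uu ue scale_scalar_mx -raddfD /=; congr (_%:M).
  transitivity (v ^+ 2 + conj a * a * (v * `|x|)).
    by rewrite [in LHS]xE; ring.
  by rewrite aa1 /s; ring.
have ww : w *m w^d = (2 * s)%:M.
  rewrite {1}/w mulmxDl uw -scalemxAl wd mulmxDr -scalemxAr eu ee.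
  rewrite !scale_scalar_mx.
  rewrite -!raddfD /= scale_scalar_mx -raddfD /=; congr (_%:M).
  rewrite xE rmorphM /= (conj_nonneg (normr_ge0 x)).
  transitivity (s + conj a * a * s); last by rewrite aa1; ring.
  by rewrite /s; ring: aa1.
pose Q := 1%:M - s^-1 *: (w^d *m w).
have Qd : Q^d = Q.
  rewrite /Q daggerB dagger1 daggerZ daggerM daggerK conj_nonneg //.
  by rewrite invr_ge0 ltW.
exists Q, (- (a * v)); split; last first.
  rewrite /Q mulmxBr mulmx1 -scalemxAr mulmxA uw mul_scalar_mx scalerA mulVf //.
  by rewrite scale1r /w opprD addrA subrr add0r scaleNr.
(* Q is Hermitian and negates [w^d], so it squares to the identity. *)
rewrite Qd {2}/Q mulmxBr mulmx1 -scalemxAr mulmxA.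
have -> : Q *m w^d = - w^d.
  rewrite /Q mulmxBl mul1mx -scalemxAl -mulmxA ww mul_mx_scalar scalerA.
  by rewrite mulrCA mulVf // mulr1 scaler_nat mulr2n opprD addrA subrr add0r.
by rewrite mulNmx scalerN opprK /Q subrK.
Qed.

Lemma unitary_unit n (Q : 'M[F]_n) : Q^d *m Q = 1%:M -> Q \in unitmx.
Proof. by case/mulmx1_unit. Qed.

Lemma dagger_row_mx m n1 n2 (M : 'M[F]_(m, n1)) (N : 'M_(m, n2)) :
  (row_mx M N)^d = col_mx M^d N^d.
Proof. by rewrite /dagger map_row_mx tr_row_mx. Qed.

Lemma dagger_col_mx m1 m2 n (M : 'M[F]_(m1, n)) (N : 'M_(m2, n)) :
  (col_mx M N)^d = row_mx M^d N^d.
Proof. by rewrite /dagger map_col_mx tr_col_mx. Qed.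

Lemma dagger_diag_block m1 m2 n1 n2 (M : 'M[F]_(m1, n1)) (N : 'M_(m2, n2)) :
  (block_mx M 0 0 N)^d = block_mx M^d 0 0 N^d.
Proof. by rewrite /dagger map_block_mx tr_block_mx !map_mx0 !trmx0. Qed.

Lemma mulmx_diag_block m1 m2 n1 n2 p1 p2 (M1 : 'M[F]_(m1, n1))
    (M2 : 'M_(m2, n2)) (N1 : 'M_(n1, p1)) (N2 : 'M_(n2, p2)) :
  block_mx M1 0 0 M2 *m block_mx N1 0 0 N2 = block_mx (M1 *m N1) 0 0 (M2 *m N2).
Proof. by rewrite mulmx_block !mul0mx !mulmx0 !addr0 !add0r. Qed.

(** K consists of the last n columns of a unitary Q taking f to the line of the first basis vector.
    A row z with z K = 0 is then a multiple of f, and z v = 0 with f v nonzero forces z = 0. *)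
Lemma kernel_complement n (f : 'rV[F]_(1 + n)) : f != 0 ->
  exists2 K : 'M_(1 + n, n), f *m K = 0 &
    forall v : 'cV_(1 + n), f *m v != 0 -> row_mx v K \in unitmx.
Proof.
move=> f_neq0; have [Q [c [QQ fQ]]] := householder f.
have Qunit := unitary_unit QQ.
have c_neq0 : c != 0.
  apply: contraNneq f_neq0 => c0; apply/eqP.
  by rewrite -(mulmxK Qunit f) fQ c0 scale0r mul0mx.
have fK : f *m rsubmx Q = 0.
  apply/rowP => i; have /rowP/(_ (rshift 1 i)) := fQ.
  rewrite -{1}(hsubmxK Q) mul_mx_row row_mxEr => ->.
  by rewrite !mxE /= mulr0.
exists (rsubmx Q) => // v fv; rewrite unitmxE unitfE.
apply/det0P => -[z z_neq0]; rewrite mul_mx_row => zX.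
have zv : z *m v = 0 by rewrite -[LHS](row_mxKl _ (z *m rsubmx Q)) zX linear0.
have zK : z *m rsubmx Q = 0 by rewrite -[LHS](row_mxKr (z *m v)) zX linear0.
have zE : z = ((z *m Q) 0 0 / c) *: f.
  apply: (can_inj (mulmxK Qunit)); rewrite -scalemxAl fQ scalerA divfK //.
  have zQ : z *m Q = row_mx (z *m lsubmx Q) 0.
    by rewrite -zK -mul_mx_row hsubmxK.
  apply/rowP => i; rewrite [RHS]mxE [delta_mx _ _ _ _]mxE.
  case: (split_ordP i) => k ->.
    have -> : lshift n k = 0 by apply/val_inj; rewrite /= ord1.
    by rewrite !eqxx mulr1.
  by rewrite mulr0 zQ row_mxEr mxE.
have: z *m v == 0 by rewrite zv.
rewrite zE -scalemxAl scaler_eq0 (negPf fv) orbF => /eqP a0.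
by rewrite zE a0 scale0r eqxx in z_neq0.
Qed.

(** * Simultaneous diagonalization of two Gram matrices *)

Hypothesis pencil : forall m n (G : 'M[F]_n.+1) (N : 'M[F]_(m, n.+1)),
  G^d = G -> N^d *m N \in unitmx ->
  exists (y : 'rV_n.+1) (a : F), y != 0 /\ y *m G = a *: (y *m (N^d *m N)).

(* When the sum S of the two Gram matrices is singular, v spans a line of
   common kernel; otherwise v is an eigenvector of the pencil and K spans its
   orthogonal with respect to S. *)
Lemma deflation m1 m2 n (A : 'M[F]_(m1, 1 + n)) (B : 'M[F]_(m2, 1 + n)) :
  exists (v : 'cV_(1 + n)) (K : 'M_(1 + n, n)),
    [/\ row_mx v K \in unitmx, (A *m v)^d *m (A *m K) = 0
      & (B *m v)^d *m (B *m K) = 0].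
Proof.
pose N := col_mx A B.
have NN : N^d *m N = A^d *m A + B^d *m B by rewrite dagger_col_mx mul_row_col.
have [Sunit|] := boolP (N^d *m N \in unitmx); last first.
  rewrite unitmxE unitfE negbK => /det0P[y y_neq0 yS].
  have /(congr1 (@dagger _ conj _ _)) : y *m N^d = 0.
    by apply: row_gram_eq0; rewrite daggerK yS mul0mx.
  rewrite daggerM daggerK dagger0 mul_col_mx.
  rewrite -col_mx0 => /eq_col_mx[Ay By].
  have [K yK Kunit] := kernel_complement y_neq0.
  exists y^d, K; rewrite Ay By !dagger0 !mul0mx; split=> //.
  apply: Kunit; apply: contraNneq y_neq0 => yy.
  by rewrite -sqr_row_eq0 yy mxE.
have GG : (A^d *m A)^d = A^d *m A by rewrite daggerM daggerK.
have [y [a [y_neq0 yG]]] := pencil GG Sunit.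
have f_neq0 : y *m (N^d *m N) != 0.
  apply: contraNneq y_neq0 => yS0.
  by rewrite -(mulmxK Sunit y) yS0 mul0mx.
have [K fK Kunit] := kernel_complement f_neq0.
have yGK : y *m (A^d *m A) *m K = 0 by rewrite yG -scalemxAl fK scaler0.
exists y^d, K; split.
- apply: Kunit; apply: contraNneq f_neq0 => yy.
  by rewrite mulmxA (row_gram_eq0 (M := N^d)) ?mul0mx // daggerK.
- by rewrite !mulmxA in yGK *; rewrite daggerM daggerK.
(* The Gram matrix of B is the difference of two forms for which y is already orthogonal to K. *)
- move: fK; rewrite NN mulmxDr mulmxDl yGK add0r.
  by rewrite daggerM daggerK !mulmxA.
Qed.

(** Induction on the number of columns: [deflation] splits off a vector v, and the induction
    hypothesis applies to A K and B K. *)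
Lemma simultaneous_gram_diag n m1 m2 (A : 'M[F]_(m1, n)) (B : 'M[F]_(m2, n)) :
  exists X : 'M_n, [/\ X \in unitmx, is_diag_mx ((A *m X)^d *m (A *m X))
    & is_diag_mx ((B *m X)^d *m (B *m X))].
Proof.
elim: n => [|n IHn] in A B *.
  by exists 1%:M; rewrite unitmx1; split=> //; apply/is_diag_mxP => -[].
have [v [K [vKunit AvK BvK]]] := deflation (A : 'M_(m1, 1 + n)) B.
have [X [Xunit AX BX]] := IHn (A *m K) (B *m K).
have diag m (C : 'M_(m, 1 + n)) : (C *m v)^d *m (C *m K) = 0 ->
    is_diag_mx ((C *m K *m X)^d *m (C *m K *m X)) ->
  is_diag_mx ((C *m row_mx v (K *m X))^d *m (C *m row_mx v (K *m X))).
  move=> CvK CX; rewrite mul_mx_row mulmxA dagger_row_mx mul_col_row.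
  rewrite is_diag_block_mx // [_ *m (C *m K *m X)]mulmxA CvK mul0mx eqxx.
  rewrite CX andbT.
  (* The lower left block is the dagger of the upper right one. *)
  rewrite -[X in X == 0]daggerK daggerM daggerK mulmxA CvK mul0mx.
  rewrite dagger0 eqxx /=.
  by apply/is_diag_mxP => i j; rewrite !ord1.
exists (row_mx v (K *m X)); split; [| exact: diag | exact: diag].
have -> : row_mx v (K *m X) = row_mx v K *m block_mx 1%:M 0 0 X.
  by rewrite mul_row_block !mulmx0 addr0 add0r mulmx1.
have blockunit : block_mx 1%:M 0 0 X \in @unitmx F (1 + n).
  by rewrite unitmxE det_ublock det1 mul1r -unitmxE.
by rewrite unitmx_mul vKunit blockunit.
Qed.

(** * Unitary diagonalization of a matrix with orthogonal columns *)

Lemma is_diag_gram_perm m n (M : 'M[F]_(m, n)) (s : 'S_n) :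
  is_diag_mx (M^d *m M) ->
  is_diag_mx ((M *m perm_mx s)^d *m (M *m perm_mx s)).
Proof.
move/is_diag_mxP => MM; apply/is_diag_mxP => i j i_neq_j.
transitivity ((M^d *m M) ((s^-1)%g i) ((s^-1)%g j)).
  rewrite -[s]invgK -col_permE invgK !mxE.
  by apply: eq_bigr => k _; rewrite !daggerE !mxE.
by apply: MM; rewrite (inj_eq val_inj) (inj_eq perm_inj).
Qed.

(** Supplies the row u and column j that become first in [unitary_diag]. If column j is nonzero, its
    dagger serves as u, since orthogonality of the columns leaves only entry j in u M. *)
Lemma diagonal_direction m n (M : 'M[F]_(1 + m, 1 + n)) :
  is_diag_mx (M^d *m M) ->
  exists (u : 'rV_(1 + m)) (j : 'I_(1 + n)) a b,
    [/\ u != 0, u *m M = a *: delta_mx 0 j, col j M = b *: u^d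
      & (n <= m)%N -> j = 0].
Proof.
move=> MM.
have nzcol j : col j M != 0 -> ((n <= m)%N -> j = 0) ->
  exists (u : 'rV_(1 + m)) (j : 'I_(1 + n)) a b,
    [/\ u != 0, u *m M = a *: delta_mx 0 j, col j M = b *: u^d
      & (n <= m)%N -> j = 0].
  move=> Mj j0; exists (col j M)^d, j, ((M^d *m M) j j), 1; split => //.
  - by apply: contraNneq Mj => uj; rewrite -[_ M]daggerK uj dagger0.
  - apply/rowP => k; rewrite [in RHS]mxE mxE.
    transitivity ((M^d *m M) j k).
      by rewrite mxE; apply: eq_bigr => i _; rewrite !daggerE !mxE.
    have [->|k_neq_j] := eqVneq k j.
      by rewrite [delta_mx _ _ _ _]mxE !eqxx mulr1.
    rewrite [delta_mx _ _ _ _]mxE (negPf k_neq_j) andbF mulr0.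
    by apply: (is_diag_mxP MM); rewrite (inj_eq val_inj) eq_sym.
  - by rewrite scale1r daggerK.
have [M0|Mn0] := eqVneq (col 0 M) 0; last exact: nzcol Mn0 _.
have [le_nm|nle_nm] := orP (orbN (n <= m)%N).
  (* The other n columns have rank at most n < 1 + m, so M has a nonzero left null vector, which
     allows j = 0. *)
  have: ~~ row_free M.
    rewrite /row_free -(hsubmxK M).
    have -> : lsubmx M = 0.
      apply/colP => i; have /colP/(_ i) := M0.
      by rewrite !mxE => <-; congr (M _ _); apply: val_inj.
    rewrite rank_row_0mx neq_ltn (leq_ltn_trans (rank_leq_col _)) //.
  rewrite -kermx_eq0 => /rowV0Pn[u /sub_kermxP uM u_neq0].
  by exists u, 0, 0, 0; rewrite uM M0 !scale0r.
have [->|/matrix0Pn[i [j Mij]]] := eqVneq M 0.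
  exists (delta_mx 0 0), 0, 0, 0.
  rewrite mulmx0 linear0 !scale0r; split=> //.
  by apply/matrix0Pn; exists 0, 0; rewrite mxE eqxx oner_eq0.
apply: (nzcol j); last by rewrite (negPf nle_nm).
by apply/matrix0Pn; exists i, 0; rewrite mxE.
Qed.

Lemma diag_block_of_row_col m n (N : 'M[F]_(1 + m, 1 + n)) a b :
  row 0 N = a *: delta_mx 0 0 -> col 0 N = b *: delta_mx 0 0 ->
  N = block_mx (ulsubmx N) 0 0 (drsubmx N).
Proof.
move=> row0 col0; rewrite -{1}[N]submxK; congr block_mx; apply/matrixP => i k.
  have /rowP/(_ (rshift 1 k)) := row0; rewrite !mxE /= mulr0 => <-.
  by congr (N _ _); apply: val_inj; rewrite /= ord1.
have /colP/(_ (rshift 1 i)) := col0; rewrite !mxE /= mulr0 => <-.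
by congr (N _ _); apply: val_inj; rewrite /= ord1.
Qed.

(** Induction on the rows: a reflection moves u, and a transposition moves column j, to the first
    place. This splits off a 1 x 1 block. *)
Lemma unitary_diag m n (M : 'M[F]_(m, n)) : is_diag_mx (M^d *m M) ->
  exists (Q : 'M_m) (s : 'S_n), [/\ Q^d *m Q = 1%:M,
    is_diag_mx (Q^d *m M *m perm_mx s) & (n <= m)%N -> s = 1%g].
Proof.
elim: m => [|m IHm] in n M *.
  exists 1%:M, 1%g; rewrite dagger1 mulmx1; split=> //.
  by apply/is_diag_mxP => -[].
case: n => [|n] in M *.
  exists 1%:M, 1%g; rewrite dagger1 mulmx1; split=> //.
  by apply/is_diag_mxP => i [].
move=> MM.
have [u [j [a [b [u_neq0 uM Mj j0]]]]] :=
  diagonal_direction (MM : @is_diag_mx _ (1 + n) (1 + n) _).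
have [Q [c [QQ uQ]]] := householder u.
have QQ' := mulmx1C QQ.
have c_neq0 : c != 0.
  apply: contraNneq u_neq0 => c0.
  by rewrite -(mulmxK (unitary_unit QQ) u) uQ c0 scale0r mul0mx.
pose t : 'S_(1 + n) := tperm 0 j.
pose N : 'M_(1 + m, 1 + n) := Q^d *m M *m perm_mx t.
have row0 : row 0 N = (c^-1 * a) *: delta_mx 0 0.
  have eQ : delta_mx 0 0 *m Q^d = c^-1 *: u.
    rewrite -[delta_mx 0 0](scalerK c_neq0) -uQ -scalemxAl -mulmxA QQ'.
    by rewrite mulmx1.
  rewrite rowE /N !mulmxA eQ -!scalemxAl uM -scalemxAl scalerA; congr (_ *: _).
  rewrite -[t]invgK -col_permE; apply/rowP => k; rewrite !mxE tpermV.
  suff -> : (tperm 0 j k == j) = (k == 0) by [].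
  by rewrite -[RHS](inj_eq (@perm_inj _ (tperm 0 j))) tpermL.
have col0 : col 0 N = (b * conj c) *: delta_mx 0 0.
  have -> : col 0 N = Q^d *m col j M.
    rewrite /N -[t]invgK -col_permE; apply/colP => k.
    by rewrite tpermV !mxE tpermL; apply: eq_bigr => i _; rewrite !mxE.
  rewrite Mj -scalemxAr -daggerM uQ daggerZ scalerA; congr (_ *: _).
  by apply/matrixP => i k; rewrite daggerE !mxE andbC rmorph_nat.
have NE := diag_block_of_row_col row0 col0.
(* N is M up to a unitary factor and a column permutation, so orthogonality of the columns persists
   and passes to the lower right block. *)
have: is_diag_mx (N^d *m N).
  apply: is_diag_gram_perm.
  by rewrite daggerM daggerK -mulmxA (mulmxA Q) QQ' mul1mx.
rewrite NE dagger_diag_block mulmx_diag_block is_diag_block_mx //.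
case/and4P=> _ _ _ /IHm[Q1 [s1 [QQ1 diag1 s11]]].
pose Q2 : 'M_(1 + m) := Q *m block_mx 1%:M 0 0 Q1.
have Q2d : Q2^d = block_mx 1%:M 0 0 Q1^d *m Q^d.
  by rewrite daggerM dagger_diag_block dagger1.
have QQ2 : Q2^d *m Q2 = 1%:M.
  rewrite Q2d -mulmxA (mulmxA Q^d) QQ mul1mx mulmx_diag_block QQ1 mul1mx.
  by rewrite -scalar_mx_block.
pose s2 : 'S_(1 + n) := (t * lift0_perm s1)%g.
have diag2 : is_diag_mx (Q2^d *m M *m perm_mx s2).
  have -> : Q2^d *m M *m perm_mx s2 =
    block_mx 1%:M 0 0 Q1^d *m N *m lift0_mx (perm_mx s1).
    by rewrite Q2d perm_mxM lift0_mx_perm /N !mulmxA.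
  rewrite NE /lift0_mx !mulmx_diag_block is_diag_block_mx // !eqxx diag1 andbT.
  by apply/is_diag_mxP => i k; rewrite !ord1.
exists Q2, s2; split=> // le_nm.
by rewrite /s2 /t j0 // tperm1 mul1g s11 // /lift0_perm lift_perm1.
Qed.

(** The permutation required by B is put into X first. It keeps the columns of A X orthogonal, and A
    then asks for no permutation of its own, which would disturb B. *)
Lemma gsvd m1 m2 n (A : 'M[F]_(m1, n)) (B : 'M[F]_(m2, n)) : (n <= m1)%N ->
  exists (U : 'M_m1) (V : 'M_m2) (X : 'M_n),
    [/\ U^d *m U = 1%:M, V^d *m V = 1%:M, X \in unitmx,
        is_diag_mx (U^d *m A *m X) & is_diag_mx (V^d *m B *m X)].
Proof.
move=> le_nm1; have [X [Xunit AX BX]] := simultaneous_gram_diag A B.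
have [V [s [VV VBX _]]] := unitary_diag BX.
have [U [t [UU UAX t1]]] := unitary_diag (is_diag_gram_perm s AX).
exists U, V, (X *m perm_mx s); rewrite unitmx_mul Xunit unitmx_perm; split=> //.
  by move: UAX; rewrite t1 // perm_mx1 mulmx1 !mulmxA.
by rewrite !mulmxA in VBX *.
Qed.
End InvolutiveField.

(** * Discrete Fourier transform *)

Section Fourier.
Variables (C : numClosedFieldType) (l' : nat) (w : C).
Local Notation l := l'.+1.
Hypothesis prim_w : l.-primitive_root w.

(** The characters of the cyclic group Z/l, whose addition is that of ['I_l]. *)
Definition chi (j k : 'I_l) : C := w ^+ (j * k).

Lemma chiC j k : chi j k = chi k j.
Proof. by rewrite /chi mulnC. Qed.

Lemma chiDl i j k : chi (i + j) k = chi i k * chi j k.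
Proof.
by rewrite /chi /= !exprM (prim_expr_mod prim_w) exprD exprMn.
Qed.

Lemma chiDr i j k : chi k (i + j) = chi k i * chi k j.
Proof. by rewrite !(chiC k) chiDl. Qed.

Lemma chi0l k : chi 0 k = 1.
Proof. by rewrite /chi mul0n expr0. Qed.

Lemma chiNl j k : chi (- j) k = (chi j k)^-1.
Proof.
have chi_neq0 : chi j k != 0.
  by rewrite expf_neq0 // (prim_root_eq0 prim_w).
by apply: (mulIf chi_neq0); rewrite -chiDl addNr chi0l mulVf.
Qed.

Lemma chiNr j k : chi j (- k) = (chi j k)^-1.
Proof. by rewrite !(chiC j) chiNl. Qed.

Lemma norm_chi j k : `|chi j k| = 1.
Proof.
apply/eqP; rewrite -(@pexpr_eq1 _ _ l) // -normrX -exprM mulnC exprM.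
by rewrite (prim_expr_order prim_w) expr1n normr1.
Qed.

(** Orthogonality of characters: translating k by 1 multiplies the sum by w^j, which differs from 1
    when j is nonzero. *)
Lemma sum_chi j : \sum_k chi k j = if j == 0 then l%:R else 0.
Proof.
have [->|j_neq0] := eqVneq j 0.
  by under eq_bigr do rewrite chiC chi0l; rewrite sumr_const card_ord.
pose o : 'I_l := inZp 1.
have chi1 : chi o j != 1.
  rewrite /chi exprM (prim_expr_mod prim_w) expr1 -(prim_order_dvd prim_w).
  by rewrite gtnNdvd // lt0n.
apply: (mulIf (_ : 1 - chi o j != 0)); first by rewrite subr_eq0 eq_sym.
rewrite mul0r mulrBr mulr1 mulr_suml [X in X - _](reindex_inj (addIr o)) /=.
by apply/eqP; rewrite subr_eq0; apply/eqP/eq_bigr => k _; rewrite chiDl.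
Qed.

Definition fourier m n (G : 'I_l -> 'M[C]_(m, n)) (k : 'I_l) : 'M[C]_(m, n) :=
  \sum_j chi j k *: G j.

(** Serves as Fourier inversion; orthogonality of characters leaves only the term of index - k. *)
Lemma fourier_fourier m n (G : 'I_l -> 'M[C]_(m, n)) k :
  fourier (fourier G) k = l%:R *: G (- k).
Proof.
rewrite /fourier; under eq_bigr do rewrite scaler_sumr.
rewrite exchange_big /= (bigD1 (- k)) //= [X in _ + X]big1; last first.
  move=> i i_neq.
  under eq_bigr do rewrite scalerA (chiC i) -chiDr.
  rewrite -scaler_suml sum_chi.
  by rewrite addrC addr_eq0 (negPf i_neq) scale0r.
under eq_bigr do rewrite scalerA (chiC (- k)) -chiDr subrr.
by rewrite -scaler_suml sum_chi eqxx addr0.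
Qed.

Lemma fourier_inj m n (G H : 'I_l -> 'M[C]_(m, n)) :
  fourier G =1 fourier H -> G =1 H.
Proof.
move=> GH k; apply: (scalerI (_ : l%:R != 0 :> C)); first by rewrite pnatr_eq0.
rewrite -[k]opprK -!fourier_fourier.
by apply: eq_bigr => j _; rewrite GH.
Qed.

(** Translating i by j makes the character factor in the double sum. *)
Lemma fourier_conv m n p (G : 'I_l -> 'M[C]_(m, n)) (H : 'I_l -> 'M_(n, p)) k :
  fourier (fun i => \sum_j G (i - j) *m H j) k = fourier G k *m fourier H k.
Proof.
rewrite /fourier mulmx_sumr; under eq_bigr do rewrite scaler_sumr.
rewrite exchange_big; apply: eq_bigr => j _ /=.
rewrite (reindex_inj (addIr j)) mulmx_suml; apply: eq_bigr => i _ /=.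
by rewrite addrK chiDl -scalerA -scalemxAl -scalemxAr scalemxAr.
Qed.

End Fourier.

(** * Real and complex generalized singular values *)

Section PencilEigenvectors.

Lemma pencil_eigenvector (F : fieldType) n (G S : 'M[F]_n.+1) a :
  S \in unitmx -> eigenvalue (G *m invmx S) a ->
  exists (y : 'rV_n.+1) (a : F), y != 0 /\ y *m G = a *: (y *m S).
Proof.
move=> Sunit /eigenvalueP[y yGS y_neq0]; exists y, a; split=> //.
by rewrite scalemxAl -yGS mulmxA mulmxKV.
Qed.

Variable R : rcfType.
Local Notation C := R[i].
Local Notation conjC := (@conjc R : {rmorphism C -> C}).
Local Notation toC := (map_mx (real_complex R)).

Lemma mul_conjc (x : C) : x * conjC x = `|x| ^+ 2.
Proof. exact/esym/normCK. Qed.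

Lemma dagger_toC m n (M : 'M[R]_(m, n)) : dagger conjC (toC M) = toC M^T.
Proof. by apply/matrixP => i j; rewrite !mxE; exact: conjc_real. Qed.

Lemma conj_toC m n (M : 'M[R]_(m, n)) : map_mx conjC (toC M) = toC M.
Proof. by apply/matrixP => i j; rewrite !mxE; exact: conjc_real. Qed.

Lemma complex_pencil m n (G : 'M[C]_n.+1) (N : 'M[C]_(m, n.+1)) :
  dagger conjC N *m N \in unitmx ->
  exists (y : 'rV_n.+1) (a : C),
    y != 0 /\ y *m G = a *: (y *m (dagger conjC N *m N)).
Proof.
move=> Sunit.
have [//|a eig_a] := eigenvalue_closed (G *m invmx (dagger conjC N *m N)).
exact: pencil_eigenvector eig_a.
Qed.

(* A complex eigenvalue a of the real pencil is real, being the quotient of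
   the values at an eigenvector of two Hermitian forms. *)
Lemma real_pencil m n (G : 'M[R]_n.+1) (N : 'M[R]_(m, n.+1)) :
  G^T = G -> N^T *m N \in unitmx ->
  exists (y : 'rV_n.+1) (a : R), y != 0 /\ y *m G = a *: (y *m (N^T *m N)).
Proof.
move=> GG Sunit; pose S := N^T *m N.
have [//|a eig_a] := eigenvalue_closed (toC (G *m invmx S)).
have /eigenvalueP[z] := eig_a; rewrite map_mxM map_invmx => zGS z_neq0.
have ScE : toC S = dagger conjC (toC N) *m toC N by rewrite dagger_toC map_mxM.
have Scunit : toC S \in unitmx by rewrite map_unitmx.
have zG : z *m toC G = a *: (z *m toC S).
  by rewrite scalemxAl -zGS mulmxA mulmxKV.
pose q := (z *m toC S *m dagger conjC z) 0 0.
have zE : z *m toC S *m dagger conjC z =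
    z *m dagger conjC (toC N) *m dagger conjC (z *m dagger conjC (toC N)).
  by rewrite daggerM (daggerK mul_conjc) ScE !mulmxA.
have q_ge0 : 0 <= q by rewrite /q zE (sqr_row_ge0 mul_conjc).
have q_neq0 : q != 0.
  rewrite /q zE (sqr_row_eq0 mul_conjc).
  apply: contraNneq z_neq0 => zN.
  by rewrite -(mulmxK Scunit z) ScE mulmxA zN !mul0mx.
pose p := (z *m toC G *m dagger conjC z) 0 0.
have pE : p = a * q by rewrite /p zG -scalemxAl mxE.
have p_conj : conjC p = p.
  rewrite /p -daggerE; congr (fun_of_matrix _ 0 0).
  by rewrite !daggerM (daggerK mul_conjc) dagger_toC GG mulmxA.
have a_conj : conjC a = a.
  apply: (mulIf q_neq0); rewrite -pE -p_conj pE rmorphM /=.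
  by rewrite (conj_nonneg mul_conjc q_ge0).
have aE : a = real_complex R (complex.Re a).
  by case: a a_conj {eig_a zGS zG pE} => x y [] /eqP; rewrite eqNr => /eqP->.
(* A real eigenvalue of the complexified matrix is one of the real matrix, so it has a real
   eigenvector. *)
by rewrite aE eigenvalue_map in eig_a; exact: pencil_eigenvector eig_a.
Qed.

Lemma complex_gsvd m1 m2 n (A : 'M[C]_(m1, n)) (B : 'M[C]_(m2, n)) :
  (n <= m1)%N ->
  exists (U : 'M_m1) (V : 'M_m2) (X : 'M_n),
    [/\ dagger conjC U *m U = 1%:M, dagger conjC V *m V = 1%:M,
        X \in unitmx, is_diag_mx (dagger conjC U *m A *m X)
      & is_diag_mx (dagger conjC V *m B *m X)].
Proof.
apply: (gsvd mul_conjc) => [x x_ge0|p q G N _]; last exact: complex_pencil.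
by exists (sqrtC x); rewrite ?sqrtC_ge0 ?sqrtCK.
Qed.

(** With the identity as involution, the dagger is the transpose. *)
Lemma real_gsvd m1 m2 n (A : 'M[R]_(m1, n)) (B : 'M[R]_(m2, n)) :
  (n <= m1)%N ->
  exists (U : 'M_m1) (V : 'M_m2) (X : 'M_n),
    [/\ U^T *m U = 1%:M, V^T *m V = 1%:M,
        X \in unitmx, is_diag_mx (U^T *m A *m X)
      & is_diag_mx (V^T *m B *m X)].
Proof.
have dag_id m n0 (M : 'M[R]_(m, n0)) : dagger idfun M = M^T.
  by rewrite /dagger map_mx_id.
move=> le_nm1.
have [x|x x_ge0|p q G N|U [V [X []]]] :=
  @gsvd R idfun _ _ _ m1 m2 n A B le_nm1.
- by rewrite real_normK ?num_real // expr2.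
- by exists (Num.sqrt x); rewrite ?sqrtr_ge0 ?sqr_sqrtr.
- by rewrite !dag_id; exact: real_pencil.
- by rewrite !dag_id; exists U, V, X.
Qed.

(** * Factorizations compatible with conjugation *)

Definition gsvd_factors m1 m2 n (A : 'M[C]_(m1, n)) (B : 'M[C]_(m2, n))
    (Z : 'M[C]_m1 * 'M[C]_m2 * 'M[C]_n) : Prop :=
  [/\ dagger conjC Z.1.1 *m Z.1.1 = 1%:M, dagger conjC Z.1.2 *m Z.1.2 = 1%:M,
      Z.2 \in unitmx, is_diag_mx (dagger conjC Z.1.1 *m A *m Z.2)
    & is_diag_mx (dagger conjC Z.1.2 *m B *m Z.2)].

Definition conj_factors m1 m2 n (Z : 'M[C]_m1 * 'M[C]_m2 * 'M[C]_n) :=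
  (map_mx conjC Z.1.1, map_mx conjC Z.1.2, map_mx conjC Z.2).

Lemma is_diag_map (F K : nzRingType) (f : {rmorphism F -> K}) m n
    (M : 'M[F]_(m, n)) :
  is_diag_mx M -> is_diag_mx (map_mx f M).
Proof.
move/is_diag_mxP => M0; apply/is_diag_mxP => i j ij.
by rewrite mxE M0 // rmorph0.
Qed.

Lemma map_dagger m n (M : 'M[C]_(m, n)) :
  dagger conjC (map_mx conjC M) = map_mx conjC (dagger conjC M).
Proof. by rewrite /dagger map_trmx. Qed.

Lemma gsvd_factors_conj m1 m2 n (A : 'M[C]_(m1, n)) (B : 'M[C]_(m2, n)) Z :
  gsvd_factors A B Z ->
  gsvd_factors (map_mx conjC A) (map_mx conjC B) (conj_factors Z).
Proof.
case=> UU VV Xunit AD BD; rewrite /gsvd_factors /= !map_dagger -!map_mxM.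
by rewrite UU VV !map_mx1 map_unitmx; split=> //; exact: is_diag_map.
Qed.

(** Real factors for a real pair are what the indices with k = - k call for. *)
Lemma gsvd_factors_ex m1 m2 n (A : 'M[C]_(m1, n)) (B : 'M[C]_(m2, n)) :
  (n <= m1)%N -> exists Z, gsvd_factors A B Z /\
    (map_mx conjC A = A -> map_mx conjC B = B -> conj_factors Z = Z).
Proof.
have real_mx p q (M : 'M[C]_(p, q)) :
    map_mx conjC M = M -> exists M0, M = toC M0.
  move=> MM; exists (map_mx (@complex.Re R) M).
  apply/matrixP => i j; rewrite !mxE.
  have /matrixP/(_ i j) := MM; rewrite mxE; case: (M i j) => x y [] /eqP.
  by rewrite eqNr => /eqP->.
move=> le_nm1.
have [/andP[/eqP/real_mx[A0 ->] /eqP/real_mx[B0 ->]]|not_real] :=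
  boolP ((map_mx conjC A == A) && (map_mx conjC B == B)).
  have [U [V [X [UU VV Xunit AD BD]]]] := real_gsvd A0 B0 le_nm1.
  exists (toC U, toC V, toC X); split=> [|_ _]; last first.
    by rewrite /conj_factors !conj_toC.
  rewrite /gsvd_factors /= !dagger_toC -!map_mxM UU VV !map_mx1 map_unitmx.
  by split=> //; exact: is_diag_map.
have [U [V [X UVX]]] := complex_gsvd A B le_nm1.
exists (U, V, X); split=> // AA BB.
by rewrite AA BB !eqxx in not_real.
Qed.

(** Of k and - k, the one with the smaller representative keeps its chosen factors, and the other
    receives their conjugates. *)
Lemma gsvd_factors_family l m1 m2 n (A : 'I_l.+1 -> 'M[C]_(m1, n))
    (B : 'I_l.+1 -> 'M[C]_(m2, n)) : (n <= m1)%N ->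
  (forall k, map_mx conjC (A k) = A (- k)) ->
  (forall k, map_mx conjC (B k) = B (- k)) ->
  exists Z, (forall k, gsvd_factors (A k) (B k) (Z k)) /\
    (forall k, conj_factors (Z k) = Z (- k)).
Proof.
move=> le_nm1 Aconj Bconj.
have conjCK p q (M : 'M[C]_(p, q)) : map_mx conjC (map_mx conjC M) = M.
  by apply/matrixP => i j; rewrite !mxE; exact: conjcK.
have conj_factorsK Z : conj_factors (@conj_factors m1 m2 n Z) = Z.
  by case: Z => [[U V] X]; rewrite /conj_factors /= !conjCK.
have /fin_all_exists[Z ZP] (k : 'I_l.+1) := gsvd_factors_ex (A k) (B k) le_nm1.
exists (fun k : 'I_l.+1 =>
  if (k <= (- k)%R)%N then Z k else conj_factors (Z (- k))).
split=> k.
  case: ifP => _; first by case: (ZP k).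
  rewrite -[k in A k]opprK -[k in B k]opprK -Aconj -Bconj.
  by apply: gsvd_factors_conj; case: (ZP (- k)).
rewrite opprK; have [lt_k|lt_k|eq_k] := ltngtP k (- k) => //.
(* Here k = - k, so A k and B k are real and the chosen factors are self-conjugate. *)
rewrite -(val_inj eq_k); apply: (ZP k).2.
  by rewrite Aconj -(val_inj eq_k).
by rewrite Bconj -(val_inj eq_k).
Qed.

End PencilEigenvectors.

(** * Tensors *)

Section TensorFourier.

Lemma subiE l (i j : 'I_l.+1) : subi i j = i - j.
Proof. by apply: val_inj; rewrite /= modnDmr. Qed.

(** Block circulant multiplication is cyclic convolution, the form that [fourier_conv] handles. *)
Lemma tmulE (R : pzRingType) m n p l (A : tensor R m n l.+1)
    (B : tensor R n p l.+1) i :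
  (A *t B) i = \sum_j A (i - j) *m B j.
Proof.
rewrite ffunE mul_mxblock_mxrow mxcolK.
by apply: eq_bigr => j _; rewrite subiE.
Qed.

Lemma ttrE (R : Type) m n l (A : tensor R m n l.+1) i : A^tr i = (A (- i))^T.
Proof. by rewrite ffunE; congr ((A _)^T); apply: val_inj. Qed.

Variables (R : rcfType) (l : nat) (w : R[i]).
Hypothesis prim_w : l.+1.-primitive_root w.
Local Notation conjC := (@conjc R : {rmorphism R[i] -> R[i]}).
Local Notation toC := (map_mx (real_complex R)).

Definition dft m n (A : tensor R m n l.+1) : 'I_l.+1 -> 'M[R[i]]_(m, n) :=
  fourier w (fun k => toC (A k)).

(** Character values have norm one, so conjugation inverts them. *)
Lemma conj_chi (j k : 'I_l.+1) : conjC (chi w j k) = chi w j (- k).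
Proof.
have chi_neq0 : chi w j k != 0 by rewrite -normr_eq0 (norm_chi prim_w) oner_eq0.
rewrite (chiNr prim_w); apply: (mulfI chi_neq0); rewrite mulfV //.
by rewrite mul_conjc (norm_chi prim_w) expr1n.
Qed.

Lemma conj_fourier m n (G : 'I_l.+1 -> 'M[R[i]]_(m, n)) k :
  map_mx conjC (fourier w G k) = fourier w (fun j => map_mx conjC (G j)) (- k).
Proof.
rewrite /fourier map_mx_sum; apply: eq_bigr => j _.
by rewrite map_mxZ; congr (_ *: _); exact: conj_chi.
Qed.

Lemma conj_dft m n (A : tensor R m n l.+1) k :
  map_mx conjC (dft A k) = dft A (- k).
Proof. by rewrite conj_fourier; apply: eq_bigr => j _; rewrite conj_toC. Qed.

Lemma dft_tmul m n p (A : tensor R m n l.+1) (B : tensor R n p l.+1) k :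
  dft (A *t B) k = dft A k *m dft B k.
Proof.
rewrite -(fourier_conv prim_w); apply: eq_bigr => i _.
rewrite tmulE map_mx_sum; congr (_ *: _).
by apply: eq_bigr => j _; rewrite map_mxM.
Qed.

(** Reversing the slices inverts the characters, which for real slices amounts to conjugating the
    transform. *)
Lemma dft_ttr m n (A : tensor R m n l.+1) k :
  dft A^tr k = dagger conjC (dft A k).
Proof.
rewrite /dagger conj_dft /dft /fourier (reindex_inj oppr_inj) linear_sum /=.
apply: eq_bigr => j _; rewrite linearZ /= ttrE opprK map_trmx.
by rewrite (chiNr prim_w) (chiNl prim_w).
Qed.

Lemma dft_tid m k : dft (tid : tensor R m m l.+1) k = 1%:M.
Proof.
rewrite /dft /fourier (bigD1 0) //= big1 => [|j j_neq0].
  by rewrite ffunE eqxx map_mx1 chi0l scale1r addr0.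
by rewrite ffunE -[0%N]/(val (0 : 'I_l.+1)) (inj_eq val_inj) (negPf j_neq0)
           map_mx0 scaler0.
Qed.

Lemma dft_inj m n (A B : tensor R m n l.+1) : dft A =1 dft B -> A = B.
Proof.
move=> /(fourier_inj prim_w) AB; apply/ffunP => k.
exact: map_mx_inj (AB k).
Qed.

(** The slices G come from Fourier inversion. The symmetry of F makes them real, so taking real
    parts loses nothing. *)
Lemma dft_surj m n (F : 'I_l.+1 -> 'M[R[i]]_(m, n)) :
  (forall k, map_mx conjC (F k) = F (- k)) ->
  exists A : tensor R m n l.+1, dft A =1 F.
Proof.
move=> Fconj; pose G j := l.+1%:R^-1 *: fourier w F (- j).
have Gconj j : map_mx conjC (G j) = G j.
  rewrite /G map_mxZ conj_fourier opprK; congr (_ *: _).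
    by rewrite fmorphV rmorph_nat.
  rewrite /fourier (reindex_inj oppr_inj); apply: eq_bigr => k _.
  by rewrite Fconj opprK (chiNl prim_w) (chiNr prim_w).
exists [ffun j => map_mx (@complex.Re R) (G j)] => k.
have -> : dft [ffun j => map_mx (@complex.Re R) (G j)] k = fourier w G k.
  apply: eq_bigr => j _; congr (_ *: _); apply/matrixP => a b; rewrite ffunE.
  have /matrixP/(_ a b) := Gconj j; rewrite !mxE.
  by case: (_ * _) => x y [] /eqP; rewrite eqNr => /eqP->.
rewrite /G /fourier; under eq_bigr do rewrite scalerA mulrC -scalerA.
(* Negating the index exhibits a double transform, evaluated at - k. *)
rewrite -scaler_sumr (reindex_inj oppr_inj) /=.
under eq_bigr do rewrite opprK (chiNl prim_w) -(chiNr prim_w).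
rewrite (_ : \sum_i _ = fourier w (fourier w F) (- k)) // fourier_fourier //.
by rewrite opprK scalerA mulVf ?scale1r ?pnatr_eq0.
Qed.

Lemma is_diag_fourier m n (G : 'I_l.+1 -> 'M[R[i]]_(m, n)) k :
  (forall j, is_diag_mx (G j)) -> is_diag_mx (fourier w G k).
Proof.
move=> Gdiag; apply/is_diag_mxP => a b ab; rewrite summxE big1 // => j _.
by rewrite mxE (is_diag_mxP (Gdiag j)) ?mulr0.
Qed.

(** Up to the factor l + 1, each slice of A is a linear combination of the diagonal slices of its
    transform. *)
Lemma f_diagonal_dft m n (A : tensor R m n l.+1) :
  (forall k, is_diag_mx (dft A k)) -> f_diagonal A.
Proof.
move=> Adiag k; have := is_diag_fourier (- k) Adiag.
rewrite (fourier_fourier prim_w) opprK => /is_diag_mxP Ak0.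
apply/is_diag_mxP => a b /Ak0/eqP.
rewrite !mxE mulf_eq0 pnatr_eq0 /= => /eqP Aab.
exact: complexI Aab.
Qed.

End TensorFourier.

(** X^n - 1 is separable in characteristic zero, so it has n distinct roots, and these include a
    primitive one. *)
Lemma primitive_root_exists (C : numClosedFieldType) n :
  (0 < n)%N -> exists z : C, n.-primitive_root z.
Proof.
move=> n_gt0; have [rs rsE] := closed_field_poly_normal ('X^n - 1 : {poly C}).
rewrite (monicP (monicXnsubC _ n_gt0)) scale1r in rsE.
have unity_rs : all n.-unity_root rs.
  by apply/allP => z z_rs; rewrite /root_of_unity rsE root_prod_XsubC.
have size_rs : (n <= size rs)%N.
  by rewrite -ltnS -(size_prod_XsubC _ id) -rsE size_XnsubC.
have uniq_rs : uniq rs.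
  by rewrite -separable_prod_XsubC -rsE separable_Xn_sub_1 // pnatr_eq0 -lt0n.
have /hasP[z _ prim_z] := has_prim_root n_gt0 unity_rs uniq_rs size_rs.
by exists z.
Qed.

(** * Assembly of the tensor decomposition *)

Theorem theorem4p1 (R : realType) (m1 m2 n1 n : nat)
    (m1_gt0 : (0 < m1)%N) (m2_gt0 : (0 < m2)%N)
    (n1_gt0 : (0 < n1)%N) (n_gt0 : (0 < n)%N) (le_n1_m1 : (n1 <= m1)%N)
    (A : tensor R m1 n1 n) (B : tensor R m2 n1 n) :
  exists (U : tensor R m1 m1 n) (V : tensor R m2 m2 n) (X : tensor R n1 n1 n)
         (DA : tensor R m1 n1 n) (DB : tensor R m2 n1 n),
    [/\ orthogonal_tensor U, orthogonal_tensor V & invertible_tensor X] /\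
    [/\ U^tr *t A *t X = DA, V^tr *t B *t X = DB, f_diagonal DA & f_diagonal DB].
Proof.
(* Writing n as a successor gives the slice indices their cyclic group structure. *)
case: n n_gt0 A B => // l _ A B.
have [w prim_w] := primitive_root_exists R[i] (ltn0Sn l).
have [Z [ZP Zconj]] := gsvd_factors_family le_n1_m1
  (conj_dft prim_w A) (conj_dft prim_w B).
have [U UE] := dft_surj prim_w (fun k => congr1 (fun Z => Z.1.1) (Zconj k)).
have [V VE] := dft_surj prim_w (fun k => congr1 (fun Z => Z.1.2) (Zconj k)).
have [X XE] := dft_surj prim_w (fun k => congr1 snd (Zconj k)).
(* The slicewise inverses have the same conjugate symmetry, so they come from a real tensor, the
   inverse of X. *)
have [|Y YE] := @dft_surj _ _ _ prim_w _ _ (fun k => invmx (Z k).2).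
  by move=> k; rewrite map_invmx -Zconj.
exists U, V, X, (U^tr *t A *t X), (V^tr *t B *t X); split; split => //.
- split; apply: (dft_inj prim_w) => k; have [UU _ _ _ _] := ZP k;
    rewrite (dft_tmul prim_w) (dft_ttr prim_w) dft_tid UE //.
  exact: mulmx1C.
- split; apply: (dft_inj prim_w) => k; have [_ VV _ _ _] := ZP k;
    rewrite (dft_tmul prim_w) (dft_ttr prim_w) dft_tid VE //.
  exact: mulmx1C.
- exists Y; split; apply: (dft_inj prim_w) => k; have [_ _ Xunit _ _] := ZP k;
    by rewrite (dft_tmul prim_w) dft_tid XE YE (mulmxV, mulVmx).
- apply: (f_diagonal_dft prim_w) => k; have [_ _ _ AD _] := ZP k.
  by rewrite !(dft_tmul prim_w) (dft_ttr prim_w) UE XE.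
- apply: (f_diagonal_dft prim_w) => k; have [_ _ _ _ BD] := ZP k.
  by rewrite !(dft_tmul prim_w) (dft_ttr prim_w) VE XE.
Qed.
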